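(* Let $\mathcal{E}$ be a locally cartesian closed category with disjoint finite sums, and let $I,J\in\mathcal{E}$. Then the family of functors (indexed by natural numbers $n$) $$\mathbf{homterm}_n\colon\mathbf{Poly}(\mathcal{E})(I,J)\to\mathbf{Poly}_n(\mathcal{E})(I,J)$$ defined by sending a polynomial $I\xleftarrow{s}E\xrightarrow{p}B\xrightarrow{t}J$ to $$I\xleftarrow{\;s\cdot e\;}n\cdot{}_{p_n}E\xrightarrow{\;\mathrm{codiag}\;}{}_{p_n}E\xrightarrow{\;t\cdot p_n\;}J,$$ where $$\begin{array}{ccc} n\cdot{}_{p_n}E&\xrightarrow{\ \mathrm{codiag}\ }&{}_{p_n}E\\ {\scriptstyle e}\downarrow&&\downarrow{\scriptstyle p_n}\\ E&\xrightarrow{\ p\ }&B\end{array}$$ is the $n$-fibre pullback about $p$, are coreflection right adjoints to the inclusions $$\mathbf{inc}_n\colon\mathbf{Poly}_n(\mathcal{E})(I,J)\to\mathbf{Poly}(\mathcal{E})(I,J)$$ of order $n$ homogeneous polynomials into general polynomials.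
   Context: $\mathcal{E}$ is locally cartesian closed if it has pullbacks and each pullback functor $\Delta_p\colon\mathcal{E}/B\to\mathcal{E}/E$ has a right adjoint $\Pi_p$. A polynomial from $I$ to $J$ is a diagram $I\xleftarrow{s}E\xrightarrow{p}B\xrightarrow{t}J$ in $\mathcal{E}$. A cartesian map of polynomials $(s_1,p_1,t_1)\to(s_2,p_2,t_2)$ is a pair of maps $a\colon E_1\to E_2$, $b\colon B_1\to B_2$ with $s_2a=s_1$, $t_2b=t_1$, such that the square $p_2a=bp_1$ is a pullback. $\mathbf{Poly}(\mathcal{E})(I,J)$ is the category of polynomials from $I$ to $J$ and cartesian maps. $\mathbf{Poly}_n(\mathcal{E})(I,J)$ is the full subcategory of order $n$ homogeneous polynomials, i.e. those whose middle map is a product projection $\pi_2\colon n\times A\to A$; here $n$ denotes $n$ copies of the terminal object, so that $n\times A\cong n\cdot A$ is the $n$-fold copower of $A$ and $\pi_2$ is the codiagonal $\mathrm{codiag}\colon n\cdot A\to A$. The $n$-fibre pullback about $p\colon E\to B$ is the terminal pullback square of the form $$\begin{array}{ccc} n\times A&\xrightarrow{\pi_2}&A\\ \downarrow&&\downarrow\\ E&\xrightarrow{p}&B\end{array}$$ meaning that any other pullback square over $p$ with top edge a projection $\pi_2\colon n\times A'\to A'$ factors uniquely as a pullback square (from $n\times A'\to A'$ to $n\times A\to A$) pasted on top of it. The symbols ${}_{p_n}E$, $p_n$ and $e$ denote the top right object, right-hand map and left-hand map of this square. ''Coreflection right adjoint'' means right adjoint to the full inclusion $\mathbf{inc}_n$,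 with $\mathbf{homterm}_n\cdot\mathbf{inc}_n$ isomorphic to the identity.
   Formalization: The existence of an n-fibre pullback about the middle map of every polynomial from I to J is assumed, since it can fail: in sets with an action of G = Z/2 there is no 2-fibre pullback about G → 1. *)

(* Defs.v *)
From Stdlib Require Import ProofIrrelevance ClassicalEpsilon.
From mathcomp Require Import all_boot.

Set Implicit Arguments.
Unset Strict Implicit.
Unset Printing Implicit Defensive.

(** * Categories, functors, adjunctions *)

Record category := Category {
  ob :> Type;
  hom : ob -> ob -> Type;
  idm : forall X, hom X X;
  comp : forall X Y Z, hom Y Z -> hom X Y -> hom X Z;
  comp1m : forall X Y (f : hom X Y), comp (idm Y) f = f;
  compm1 : forall X Y (f : hom X Y), comp f (idm X) = f;
  compmA : forall X Y Z W (h : hom Z W) (g : hom Y Z) (f : hom X Y),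
    comp h (comp g f) = comp (comp h g) f
}.

Arguments hom {c} X Y.
Arguments idm {c} X.
Arguments comp {c X Y Z} g f.
Notation "g ∘ f" := (comp g f) (at level 40, left associativity).

(* The part of a functor lying over a prescribed map [F] on objects. *)
Record functor_on (C D : category) (F : C -> D) := FunctorOn {
  fmap : forall X Y : C, hom X Y -> hom (F X) (F Y);
  fmap_id : forall X, fmap (idm X) = idm (F X);
  fmap_comp : forall X Y Z (g : hom Y Z) (f : hom X Y),
    fmap (g ∘ f) = fmap g ∘ fmap f
}.

Record functor (C D : category) := Functor {
  fobj :> C -> D;
  fstr : functor_on fobj
}.

Arguments fmap {C D F} _ {X Y} f.
Arguments Functor {C D fobj} fstr.

Definition farr (C D : category) (F : functor C D) (X Y : C) (f : hom X Y) :
  hom (F X) (F Y) := fmap (fstr F) f.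

Definition functor_id (C : category) : functor C C.
Proof.
exists (fun X => X); exists (fun X Y f => f); by [].
Defined.

Definition functor_comp (C D E : category) (G : functor D E) (F : functor C D) :
  functor C E.
Proof.
exists (fun X => G (F X)); exists (fun X Y f => farr G (farr F f)).
- by move=> X; rewrite /farr !fmap_id.
- by move=> X Y Z g f; rewrite /farr !fmap_comp.
Defined.

Record nat_trans (C D : category) (F G : functor C D) := NatTrans {
  ncomp :> forall X, hom (F X) (G X);
  nnat : forall X Y (f : hom X Y), ncomp Y ∘ farr F f = farr G f ∘ ncomp X
}.

Definition is_iso (C : category) (X Y : C) (f : hom X Y) : Prop :=
  exists g : hom Y X, g ∘ f = idm X /\ f ∘ g = idm Y.

Definition naturally_isomorphic (C D : category) (F G : functor C D) : Prop :=
  exists a : nat_trans F G, forall X, is_iso (a X).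

(* [adjunction F G]: [F] is left adjoint to [G]. *)
Record adjunction (C D : category) (F : functor C D) (G : functor D C) :=
  Adjunction {
    adj_unit : nat_trans (functor_id C) (functor_comp G F);
    adj_counit : nat_trans (functor_comp F G) (functor_id D);
    adj_triangleF : forall X, adj_counit (F X) ∘ farr F (adj_unit X) = idm (F X);
    adj_triangleG : forall Y, farr G (adj_counit Y) ∘ adj_unit (G Y) = idm (G Y)
}.

Definition full_subcategory (C : category) (P : C -> Prop) : category.
Proof.
exists {X : C | P X} (fun X Y => hom (proj1_sig X) (proj1_sig Y))
  (fun X => idm (proj1_sig X)) (fun X Y Z g f => g ∘ f).
- by move=> X Y f; exact: comp1m.
- by move=> X Y f; exact: compm1.
- by move=> X Y Z W h g f; exact: compmA.
Defined.

Definition full_inclusion (C : category) (P : C -> Prop) :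
  functor (full_subcategory P) C.
Proof.
by refine (Functor (@FunctorOn (full_subcategory P) C (@proj1_sig C P)
                   (fun X Y f => f) _ _)).
Defined.

Definition is_coreflection (C : category) (P : C -> Prop)
    (G : functor C (full_subcategory P)) : Prop :=
  inhabited (adjunction (full_inclusion P) G) /\
  naturally_isomorphic (functor_comp G (full_inclusion P)) (functor_id _).

(** * Limits and sums *)

Definition is_terminal (C : category) (T : C) : Prop :=
  forall X, exists! u : hom X T, True.

Definition is_initial (C : category) (O : C) : Prop :=
  forall X, exists! u : hom O X, True.

Definition is_monic (C : category) (X Y : C) (m : hom X Y) : Prop :=
  forall W (u v : hom W X), m ∘ u = m ∘ v -> u = v.

Definition is_product (C : category) (A B P : C) (p1 : hom P A) (p2 : hom P B) :
  Prop :=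
  forall W (h : hom W A) (k : hom W B),
    exists! u : hom W P, p1 ∘ u = h /\ p2 ∘ u = k.

(* The square
<<
      P --p2--> Y
      |         |
     p1         g
      v         v
      X --f---> Z
>> *)
Definition is_pullback (C : category) (X Y Z P : C)
    (f : hom X Z) (g : hom Y Z) (p1 : hom P X) (p2 : hom P Y) : Prop :=
  f ∘ p1 = g ∘ p2 /\
  forall W (h : hom W X) (k : hom W Y), f ∘ h = g ∘ k ->
    exists! u : hom W P, p1 ∘ u = h /\ p2 ∘ u = k.

Definition is_sum (C : category) (n : nat) (X : 'I_n -> C) (S : C)
    (inj : forall i, hom (X i) S) : Prop :=
  forall Y (f : forall i, hom (X i) Y),
    exists! u : hom S Y, forall i, u ∘ inj i = f i.

Record pullbacks (C : category) := Pullbacks {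
  pb_ob : forall X Y Z : C, hom X Z -> hom Y Z -> C;
  pb1 : forall (X Y Z : C) (f : hom X Z) (g : hom Y Z), hom (pb_ob f g) X;
  pb2 : forall (X Y Z : C) (f : hom X Z) (g : hom Y Z), hom (pb_ob f g) Y;
  pbP : forall (X Y Z : C) (f : hom X Z) (g : hom Y Z),
    is_pullback f g (pb1 f g) (pb2 f g)
}.

Arguments pb_ob {C} p {X Y Z} f g.
Arguments pb1 {C} p {X Y Z} f g.
Arguments pb2 {C} p {X Y Z} f g.
Arguments pbP {C} p {X Y Z} f g.

Record disjoint_finite_sums (C : category) := DisjointFiniteSums {
  sum_ob : forall n, ('I_n -> C) -> C;
  sum_in : forall n (X : 'I_n -> C) i, hom (X i) (sum_ob X);
  sumP : forall n (X : 'I_n -> C), is_sum (@sum_in n X);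
  sum_in_monic : forall n (X : 'I_n -> C) i, is_monic (@sum_in n X i);
  sum_in_disjoint : forall n (X : 'I_n -> C) i j, i <> j ->
    forall (P : C) (a : hom P (X i)) (b : hom P (X j)),
      is_pullback (@sum_in n X i) (@sum_in n X j) a b -> is_initial P
}.

Arguments sum_ob {C} d {n} X.
Arguments sum_in {C} d {n} X i.
Arguments sumP {C} d {n} X.

Definition copower (C : category) (S : disjoint_finite_sums C) (n : nat) (A : C) :
  C := sum_ob S (fun _ : 'I_n => A).

Definition codiag (C : category) (S : disjoint_finite_sums C) (n : nat) (A : C) :
  hom (copower S n A) A :=
  proj1_sig (constructive_definite_description _
               (sumP S (fun _ : 'I_n => A) A (fun=> idm A))).

(** * Slices and local cartesian closure *)

Record slice_ob (C : category) (B : C) := SliceOb {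
  sdom : C;
  sarr : hom sdom B
}.

Definition slice_hom (C : category) (B : C) (X Y : slice_ob B) :=
  {f : hom (sdom X) (sdom Y) | sarr Y ∘ f = sarr X}.

Lemma sig_ext (A : Type) (P : A -> Prop) (x y : {a | P a}) :
  proj1_sig x = proj1_sig y -> x = y.
Proof.
case: x y => [x px] [y py] /= xy; case: _ / xy in py *.
by congr exist; exact: proof_irrelevance.
Qed.

Definition slice_id (C : category) (B : C) (X : slice_ob B) : slice_hom X X :=
  exist _ (idm (sdom X)) (compm1 (sarr X)).

Definition slice_comp (C : category) (B : C) (X Y Z : slice_ob B)
  (g : slice_hom Y Z) (f : slice_hom X Y) : slice_hom X Z.
Proof.
exists (proj1_sig g ∘ proj1_sig f).
by rewrite compmA (proj2_sig g) (proj2_sig f).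
Defined.

Definition slice (C : category) (B : C) : category.
Proof.
exists (slice_ob B) (@slice_hom C B) (@slice_id C B) (@slice_comp C B).
- move=> X Y [f fP]; apply: sig_ext; exact: comp1m.
- move=> X Y [f fP]; apply: sig_ext; exact: compm1.
- move=> X Y Z W [h hP] [g gP] [f fP]; apply: sig_ext; exact: compmA.
Defined.

Section PullbackFunctor.
Variables (C : category) (pb : pullbacks C) (E B : C) (p : hom E B).

Definition Delta_ob (X : slice B) : slice E := SliceOb (pb2 pb (sarr X) p).

Lemma Delta_arr_subproof (X Y : slice B) (u : hom X Y) :
  sarr Y ∘ (proj1_sig u ∘ pb1 pb (sarr X) p) = p ∘ pb2 pb (sarr X) p.
Proof. by rewrite compmA (proj2_sig u); case: (pbP pb (sarr X) p). Qed.

Lemma Delta_arr_unique (X Y : slice B) (u : hom X Y) :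
  exists! v : hom (Delta_ob X) (Delta_ob Y),
    pb1 pb (sarr Y) p ∘ proj1_sig v = proj1_sig u ∘ pb1 pb (sarr X) p.
Proof.
have [_ /(_ _ _ _ (Delta_arr_subproof u)) [v [[v1 v2] vU]]] := pbP pb (sarr Y) p.
exists (exist _ v v2); split=> // w w1; apply: sig_ext => /=.
by apply: vU; split=> //; exact: (proj2_sig w).
Qed.

Definition Delta_arr (X Y : slice B) (u : hom X Y) :
  hom (Delta_ob X) (Delta_ob Y) :=
  proj1_sig (constructive_definite_description _ (Delta_arr_unique u)).

Lemma Delta_arrE (X Y : slice B) (u : hom X Y) :
  pb1 pb (sarr Y) p ∘ proj1_sig (Delta_arr u) = proj1_sig u ∘ pb1 pb (sarr X) p.
Proof.
exact: proj2_sig (constructive_definite_description _ (Delta_arr_unique u)).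
Qed.

Lemma Delta_arr_eq (X Y : slice B) (u : hom X Y) (v : hom (Delta_ob X) (Delta_ob Y)) :
  pb1 pb (sarr Y) p ∘ proj1_sig v = proj1_sig u ∘ pb1 pb (sarr X) p ->
  Delta_arr u = v.
Proof.
have [w [_ wU]] := Delta_arr_unique u => v1.
by rewrite -(wU _ v1) (wU _ (Delta_arrE u)).
Qed.

Definition Delta : functor (slice B) (slice E).
Proof.
exists Delta_ob; exists Delta_arr.
- by move=> X; apply: Delta_arr_eq; rewrite /= compm1 comp1m.
- move=> X Y Z g f; apply: Delta_arr_eq => /=.
  by rewrite compmA Delta_arrE -compmA Delta_arrE compmA.
Defined.

End PullbackFunctor.

Definition locally_cartesian_closed (C : category) : Prop :=
  exists pb : pullbacks C, forall (E B : C) (p : hom E B),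
    exists Pi : functor (slice E) (slice B), inhabited (adjunction (Delta pb p) Pi).

(** * Polynomials and cartesian maps *)

Record poly (C : category) (I J : C) := PolyOb {
  pE : C;
  pB : C;
  ps : hom pE I;
  pp : hom pE pB;
  pt : hom pB J
}.

Arguments PolyOb {C I J pE pB} ps pp pt.

Definition poly_hom (C : category) (I J : C) (P1 P2 : poly I J) :=
  {ab : hom (pE P1) (pE P2) * hom (pB P1) (pB P2) |
    [/\ ps P2 ∘ ab.1 = ps P1,
        pt P2 ∘ ab.2 = pt P1
      & is_pullback (pp P2) ab.2 ab.1 (pp P1)]}.

Lemma is_pullback_id (C : category) (X Y : C) (f : hom X Y) :
  is_pullback f (idm Y) (idm X) f.
Proof.
split=> [|W h k]; first by rewrite compm1 comp1m.
rewrite comp1m => fh; exists h; split; first by rewrite comp1m.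
by move=> u [<- _]; rewrite comp1m.
Qed.

Lemma is_pullback_paste (C : category) (E1 E2 E3 B1 B2 B3 : C)
  (p1 : hom E1 B1) (p2 : hom E2 B2) (p3 : hom E3 B3)
  (a : hom E1 E2) (b : hom B1 B2) (a' : hom E2 E3) (b' : hom B2 B3) :
  is_pullback p3 b' a' p2 -> is_pullback p2 b a p1 ->
  is_pullback p3 (b' ∘ b) (a' ∘ a) p1.
Proof.
move=> [c' u'] [c u]; split.
  by rewrite compmA c' -compmA c compmA.
move=> W h k; rewrite -compmA => /u' [v [[v1 v2] vU]].
have [w [[w1 w2] wU]] := u _ _ _ v2.
exists w; split; first by rewrite -compmA w1.
move=> x [x1 x2]; apply: wU; split=> //; apply/esym/vU.
by rewrite compmA x1 compmA c -compmA x2.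
Qed.

Definition poly_id (C : category) (I J : C) (P : poly I J) : poly_hom P P.
Proof.
exists (idm (pE P), idm (pB P)).
by split; [exact: compm1 | exact: compm1 | exact: is_pullback_id].
Defined.

Definition poly_comp (C : category) (I J : C) (P1 P2 P3 : poly I J)
  (g : poly_hom P2 P3) (f : poly_hom P1 P2) : poly_hom P1 P3.
Proof.
exists ((proj1_sig g).1 ∘ (proj1_sig f).1, (proj1_sig g).2 ∘ (proj1_sig f).2).
case: g f => -[a' b'] [/= sa' tb' c'] [[a b] [/= sa tb c]].
by split; [rewrite compmA sa' | rewrite compmA tb' | exact: is_pullback_paste c' c].
Defined.

Definition Poly (C : category) (I J : C) : category.
Proof.
exists (poly I J) (@poly_hom C I J) (@poly_id C I J) (@poly_comp C I J).
- by move=> P Q [[a b] f]; apply: sig_ext; rewrite /= !comp1m.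
- by move=> P Q [[a b] f]; apply: sig_ext; rewrite /= !compm1.
- by move=> P Q R S h g f; apply: sig_ext; rewrite /= !compmA.
Defined.

(** * Homogeneous polynomials and fibre pullbacks *)

Section Homogeneous.
Variables (C : category) (S : disjoint_finite_sums C) (T : C) (n : nat).

(* [q] is a second projection [n × A -> A], where [n] is the [n]-fold copower of
   [T]; in use, [T] is terminal. *)
Definition is_projection (X A : C) (q : hom X A) : Prop :=
  exists k : hom X (copower S n T), is_product k q.

Definition homogeneous (I J : C) (P : Poly I J) : Prop := is_projection (pp P).

Definition Poly_n (I J : C) : category := full_subcategory (@homogeneous I J).

(* Top edge written as the codiagonal [n · A -> A]; when [C] is locally cartesian
   closed and [T] is terminal, this is a projection [n × A -> A].  The factoring
   square may have any map [X' -> n · A] on its left, not only one of the form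
   [n · b]; accordingly its maps are those of the full subcategory [Poly_n]. *)
Definition is_nfibre (E B : C) (p : hom E B) (A : C)
    (e : hom (copower S n A) E) (pn : hom A B) : Prop :=
  is_pullback p pn e (codiag S n A) /\
  forall (X' A' : C) (q' : hom X' A') (e' : hom X' E) (b' : hom A' B),
    is_projection q' -> is_pullback p b' e' q' ->
    exists! ab : hom X' (copower S n A) * hom A' A,
      [/\ is_pullback (codiag S n A) ab.2 ab.1 q',
          e ∘ ab.1 = e' & pn ∘ ab.2 = b'].

(* A choice of n-fibre pullback about [p].  It is data and not a consequence of
   local cartesian closure: in sets with an action of [G = Z/2] there is no
   2-fibre pullback about [G -> 1], because [A] would have to be a nonempty free
   [G]-set receiving a single map from [G]. *)
Record nfibre (E B : C) (p : hom E B) := NFibre {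
  nf_ob : C;
  nf_left : hom (copower S n nf_ob) E;
  nf_right : hom nf_ob B;
  nfP : is_nfibre p nf_left nf_right
}.

Variables (I J : C) (nf : forall P : Poly I J, nfibre (pp P)).

Definition homterm_poly (P : Poly I J) : Poly I J :=
  PolyOb (ps P ∘ nf_left (nf P)) (codiag S n (nf_ob (nf P)))
         (pt P ∘ nf_right (nf P)).

Definition nfibre_map (P : Poly I J) : hom (homterm_poly P) P :=
  exist _ (nf_left (nf P), nf_right (nf P))
    (And3 erefl erefl (proj1 (nfP (nf P)))).

End Homogeneous.

(* Main.v *)
(** Sums are stable under pullback in a locally cartesian closed category, since
    the pullback functors are left adjoints; hence [n · A] is the product of
    [n · T] and [A], and the codiagonal is its second projection.  So the
    n-fibre pullback is a homogeneous polynomial, and its universal property says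
    that it is couniversal among cartesian maps from homogeneous polynomials;
    such a family of couniversal arrows is a coreflection. *)

From Stdlib Require Import ClassicalEpsilon.
From mathcomp Require Import all_boot.
Require Import Defs.

Set Implicit Arguments.
Unset Strict Implicit.
Unset Printing Implicit Defensive.

Section Coreflection.
Variables (C : category) (P : C -> Prop) (G : C -> C) (PG : forall X, P (G X)).
Variable eps : forall X, hom (G X) X.
Hypothesis epsU : forall X Y (f : hom Y X), P Y ->
  exists! g : hom Y (G X), eps X ∘ g = f.

(** Existence in [epsU] is only a proposition; definite description turns each unique factorisation
    through [eps] into data. *)
Definition corestrict X Y (f : hom Y X) (PY : P Y) : hom Y (G X) :=
  proj1_sig (constructive_definite_description _ (epsU f PY)).

Lemma corestrictE X Y (f : hom Y X) (PY : P Y) : eps X ∘ corestrict f PY = f.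
Proof. exact: proj2_sig (constructive_definite_description _ (epsU f PY)). Qed.

(** Lets [eps] be cancelled against maps out of objects of [P]; the functor laws, naturality of the
    unit and one triangle identity are checked this way. *)
Lemma eps_inj X Y (g h : hom Y (G X)) : P Y -> eps X ∘ g = eps X ∘ h -> g = h.
Proof. by move=> PY; have [k [_ kU]] := epsU (eps X ∘ h) PY => /kU<-; exact: kU. Qed.

Definition coreflector_map X Y (f : hom X Y) : hom (G X) (G Y) :=
  corestrict (f ∘ eps X) (PG X).

Lemma coreflector_mapE X Y (f : hom X Y) :
  eps Y ∘ coreflector_map f = f ∘ eps X.
Proof. exact: corestrictE. Qed.

Definition coreflector :
  @functor_on C (full_subcategory P) (fun X => exist _ (G X) (PG X)).
Proof.
refine (@FunctorOn C (full_subcategory P) (fun X => exist _ (G X) (PG X))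
  coreflector_map _ _).
- move=> X; apply: eps_inj => //=.
  by rewrite coreflector_mapE comp1m compm1.
- move=> X Y Z g f; apply: eps_inj => //=.
  by rewrite coreflector_mapE compmA coreflector_mapE -!compmA coreflector_mapE.
Defined.

Definition coreflector_unit :
  nat_trans (functor_id (full_subcategory P))
            (functor_comp (Functor coreflector) (full_inclusion P)).
Proof.
exists (fun Y : full_subcategory P => corestrict (idm (proj1_sig Y)) (proj2_sig Y)).
move=> X Y f; apply: eps_inj; first exact: proj2_sig X.
rewrite /farr /= !compmA coreflector_mapE corestrictE comp1m.
by rewrite -compmA corestrictE compm1.
Defined.

Definition coreflector_counit :
  nat_trans (functor_comp (full_inclusion P) (Functor coreflector)) (functor_id C).
Proof. by exists eps => X Y f; exact: coreflector_mapE. Defined.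

(** The counit at objects of [P], read in the full subcategory, where the unit inverts it. *)
Definition coreflector_forget :
  nat_trans (functor_comp (Functor coreflector) (full_inclusion P))
            (functor_id (full_subcategory P)).
Proof.
exists (fun Y : full_subcategory P => eps (proj1_sig Y)).
by move=> X Y f; exact: coreflector_mapE.
Defined.

Lemma coreflector_is_coreflection : is_coreflection (Functor coreflector).
Proof.
split.
  split; exists coreflector_unit coreflector_counit.
    by move=> Y; exact: corestrictE.
  move=> X; apply: eps_inj => //=.
  by rewrite /farr /= compmA coreflector_mapE -compmA corestrictE.
exists coreflector_forget => Y; exists (coreflector_unit Y); split; last first.
  exact: corestrictE.
apply: eps_inj => //=.
by rewrite compmA corestrictE comp1m compm1.
Qed.

End Coreflection.

(** A cocone on the [L (X i)] transposes to one on the [X i] with vertex [R Y]; the map it induces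
    out of [A] is transposed back. *)
Lemma left_adjoint_sum (C D : category) (L : functor C D) (R : functor D C)
    (adj : adjunction L R) n (X : 'I_n -> C) A (inj : forall i, hom (X i) A) :
  is_sum inj -> is_sum (fun i => farr L (inj i)).
Proof.
case: adj => eta eps tL tR sumA Y f.
have [u [uE uU]] := sumA (R Y) (fun i => farr R (f i) ∘ eta (X i)).
have epsN Z Z' (g : hom Z Z') := nnat eps g.
have etaN Z Z' (g : hom Z Z') := nnat eta g.
rewrite /farr /= in uE uU epsN etaN tL tR *.
exists (eps Y ∘ fmap (fstr L) u); split.
  move=> i; rewrite -compmA -fmap_comp uE fmap_comp compmA epsN.
  by rewrite -compmA tL compm1.
(* Uniqueness: the transpose of [v] satisfies the equations that determine [u]. *)
move=> v vE; rewrite (uU (fmap (fstr R) v ∘ eta A)).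
  by rewrite fmap_comp compmA epsN -compmA tL compm1.
by move=> i; rewrite -compmA etaN compmA -fmap_comp vE.
Qed.

(** The mediating map [u] of [C] lies over [B] because [sarr Y ∘ u] and [sarr A] both restrict to
    [sarr (X i)] along each injection. *)
Lemma slice_sum (C : category) (B : C) n (X : 'I_n -> slice B) (A : slice B)
    (inj : forall i, hom (X i) A) :
  is_sum (fun i => proj1_sig (inj i)) -> is_sum inj.
Proof.
move=> sumA Y f.
have [u [uE uU]] := sumA _ (fun i => proj1_sig (f i)).
have uY : sarr Y ∘ u = sarr A.
  have [w [_ wU]] := sumA _ (fun i => sarr (X i)).
  rewrite -(wU (sarr Y ∘ u)) -?(wU (sarr A)) // => i.
    exact: (proj2_sig (inj i)).
  by rewrite -compmA uE; exact: (proj2_sig (f i)).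
exists (exist _ u uY); split=> [i|v vE]; apply: sig_ext; first exact: uE.
by apply: uU => i; rewrite -vE.
Qed.

Lemma sum_eq (C : category) n (X : 'I_n -> C) A (inj : forall i, hom (X i) A)
    Y (u v : hom A Y) :
  is_sum inj -> (forall i, u ∘ inj i = v ∘ inj i) -> u = v.
Proof.
move=> sumA uv; have [w [_ wU]] := sumA Y (fun i => v ∘ inj i).
by rewrite -(wU u) // -(wU v).
Qed.

Lemma sum_iso (C : category) n (X Y : 'I_n -> C) A B
    (inA : forall i, hom (X i) A) (inB : forall i, hom (Y i) B)
    (d : forall i, hom (X i) (Y i)) (f : hom A B) :
  is_sum inA -> is_sum inB -> (forall i, is_iso (d i)) ->
  (forall i, f ∘ inA i = inB i ∘ d i) -> is_iso f.
Proof.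
move=> sA sB dI fE.
(* The inverses of the [d i] are chosen as a family; [g] is the map they induce between the sums. *)
pose d' i := constructive_indefinite_description _ (dI i).
have [g [gE _]] := sB A (fun i => inA i ∘ proj1_sig (d' i)).
exists g; split.
  apply: (sum_eq sA) => i; case: (d' i) (gE i) => e [ed de] /= gi.
  by rewrite -compmA fE compmA gi -compmA ed compm1 comp1m.
apply: (sum_eq sB) => i; case: (d' i) (gE i) => e [ed de] /= gi.
by rewrite -compmA gi compmA fE -compmA de compm1 comp1m.
Qed.

Lemma codiagE (C : category) (S : disjoint_finite_sums C) n (A : C) i :
  codiag S n A ∘ sum_in S (fun=> A) i = idm A.
Proof.
by rewrite /codiag; case: constructive_definite_description => /= u ->.
Qed.

(** Since [idm A] is terminal in the slice over [A], these injections present [codiag] as an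
    [n]-fold copower of the terminal object. *)
Definition codiag_in (C : category) (S : disjoint_finite_sums C) n (A : C)
    (i : 'I_n) : @hom (slice A) (SliceOb (idm A)) (SliceOb (codiag S n A)) :=
  exist _ (sum_in S (fun=> A) i) (codiagE S A i).

Lemma codiag_slice_sum (C : category) (S : disjoint_finite_sums C) n (A : C) :
  is_sum (@codiag_in C S n A).
Proof. by apply: slice_sum; exact: sumP. Qed.

Lemma is_product_iso (C : category) (A B P Q : C) (p1 : hom P A) (p2 : hom P B)
    (j : hom Q P) :
  is_product p1 p2 -> is_iso j -> is_product (p1 ∘ j) (p2 ∘ j).
Proof.
move=> prodP [r [rj jr]] W h k; have [u [[uh uk] uU]] := prodP W h k.
exists (r ∘ u); split.
  by rewrite -!compmA (compmA j) jr comp1m.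
move=> v; rewrite -!compmA => /uU ->.
by rewrite compmA rj comp1m.
Qed.

(** Pulling back along [t : A -> T] preserves the [n]-fold sum of [idm T] and sends [idm T] to a
    copy of [idm A]. Hence [n · A] is isomorphic over [A] to the pullback of [n · T] along [t],
    which is a product because [T] is terminal. *)
Lemma codiag_is_projection (C : category) (lccC : locally_cartesian_closed C)
    (S : disjoint_finite_sums C) (T : C) (termT : is_terminal T) n (A : C) :
  is_projection S T n (codiag S n A).
Proof.
have termE X (f g : hom X T) : f = g.
  by have [u [_ uU]] := termT X; rewrite -(uU f) // -(uU g).
have [t _] := termT A; case: lccC => pb /(_ _ _ t) [Pi [adj]].
pose X : slice T := SliceOb (codiag S n T).
have sumD := left_adjoint_sum adj (@codiag_slice_sum C S n T).
(* [k] is the copower [n · t], the future first projection. *)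
have [k [kE _]] := sumP S (fun _ : 'I_n => A) (copower S n T)
  (fun i => sum_in S (fun=> T) i ∘ t).
have [Psq Pu] := pbP pb (sarr X) t.
(* [j] compares [n · A] with the pullback; it is shown below to be invertible. *)
have [j [[j1 j2] _]] := Pu _ k (codiag S n A) (termE _ _ _).
have [Qsq Qu] := pbP pb (idm T) t.
have [d [[d1 d2] _]] := Qu _ t (idm A) (termE _ _ _).
have Qinj : d ∘ pb2 pb (idm T) t = idm _.
  have [w [_ wU]] := Qu _ _ _ Qsq.
  rewrite -(wU (idm _)) ?compm1 //; apply/esym/wU; split; first exact: termE.
  by rewrite compmA d2 comp1m.
pose js : hom (SliceOb (codiag S n A) : slice A) (Delta pb t X) := exist _ j j2.
pose ds : hom (SliceOb (idm A) : slice A) (Delta pb t (SliceOb (idm T))) :=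
  exist _ d d2.
have ds_iso : is_iso ds.
  exists (exist (fun f => idm A ∘ f = pb2 pb (idm T) t) _ (comp1m _)).
  by split; apply: sig_ext.
have jsE i : js ∘ codiag_in S A i = farr (Delta pb t) (codiag_in S T i) ∘ ds.
  apply: sig_ext => /=.
  (* Both sides are maps into the pullback with components [sum_in ∘ t] and [idm A]. *)
  have [w [_ wU]] := Pu A (sum_in S (fun=> T) i ∘ t) (idm A) (termE _ _ _).
  rewrite -(wU (j ∘ _)); last by rewrite !compmA j1 j2 kE codiagE.
  apply: wU; split.
    by rewrite compmA (Delta_arrE pb t (codiag_in S T i)) -compmA d1.
  by rewrite compmA (proj2_sig (Delta_arr pb t (codiag_in S T i))).
have [r [rj jr]] := sum_iso (@codiag_slice_sum C S n A) sumD (fun=> ds_iso) jsE.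
exists k; rewrite -j1 -j2; apply: is_product_iso.
  by move=> W h l; exact: Pu (termE _ _ _).
exists (proj1_sig r); split; first exact: (congr1 (@proj1_sig _ _) rj).
exact: (congr1 (@proj1_sig _ _) jr).
Qed.

(** The n-fibre square supplies the unique pair; compatibility with [ps] and [pt] then follows, as
    the legs of [homterm_poly] are composites with [nf_left] and [nf_right]. *)
Lemma nfibre_map_couniversal (C : category) (S : disjoint_finite_sums C) (T : C)
    (I J : C) n (nf : forall P : Poly I J, nfibre S T n (pp P))
    (P Q : Poly I J) (f : hom Q P) :
  homogeneous S T n Q ->
  exists! g : hom Q (homterm_poly nf P), nfibre_map nf P ∘ g = f.
Proof.
case: f => -[a b] /= [sa tb sq] homQ.
have [_ /(_ _ _ _ _ _ homQ sq)] := nfP (nf P).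
move=> [[a' b'] [/= [sq' ea pb] abU]].
have hP : [/\ ps (homterm_poly nf P) ∘ (a', b').1 = ps Q,
              pt (homterm_poly nf P) ∘ (a', b').2 = pt Q
            & is_pullback (pp (homterm_poly nf P)) (a', b').2 (a', b').1 (pp Q)].
  by split=> //=; rewrite -compmA ?ea ?pb.
exists (exist _ (a', b') hP); split; first by apply: sig_ext; rewrite /= ea pb.
move=> [ab [/= sab tab sqab]] /(congr1 (@proj1_sig _ _)) /= [eab pab].
by apply: sig_ext => /=; apply: abU.
Qed.

(* [homterm] has the object map of [homterm_poly]; the equation determines its
   action on cartesian maps. *)
Theorem theorem4p3p1 (C : category) (lccC : locally_cartesian_closed C)
    (S : disjoint_finite_sums C) (T : C) (termT : is_terminal T)
    (I J : C) (n : nat) (nf : forall P : Poly I J, nfibre S T n (pp P)) :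
  exists (homog : forall P : Poly I J, homogeneous S T n (homterm_poly nf P))
         (homterm : @functor_on (Poly I J) (Poly_n S T n I J)
                      (fun P => exist _ (homterm_poly nf P) (homog P))),
    (forall (P Q : Poly I J) (f : hom P Q),
       nfibre_map nf Q ∘ (fmap homterm f : hom (homterm_poly nf P) (homterm_poly nf Q))
       = f ∘ nfibre_map nf P)
    /\ is_coreflection (Functor homterm).
Proof.
have homog P : homogeneous S T n (homterm_poly nf P).
  exact: codiag_is_projection.
(* The arrows [nfibre_map nf P] take the role of [eps]. *)
have couni := nfibre_map_couniversal nf.
exists homog, (coreflector homog couni); split.
  by move=> P Q f; exact: (coreflector_mapE homog couni).
exact: coreflector_is_coreflection.
Qed.
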